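(* Consider edge-weighted online bipartite matching with patience under known non-stationary (prophet) arrivals (defined in the context). Let $\kappa\in(0,1]$ and let $x^*$ be a feasible solution of the policy LP with finite support whose objective value is at least $\kappa\cdot\mathsf{OPT}_{\mathsf{LPP}}$. Then the expected total weight matched by the Skip-Algorithm run with $x^*$ is at least $\tfrac{\kappa}{2}\cdot\mathsf{OPT}_{\mathsf{LPP}}$; in particular the Skip-Algorithm is $\kappa/2$-competitive.
   Context: Offline vertices $U$; a finite set $V$ of online types; edge weights $w_{uv}\ge0$ and edge probabilities $p_{uv}\in[0,1]$ for $u\in U,v\in V$; each type $v$ has a patience model (a deterministic positive integer, or a random positive integer with known distribution revealed only when exhausted). There are $T$ time steps; at time $t$ an online vertex arrives whose type is $v$ with probability $q_{tv}$ ($\sum_v q_{tv}=1$), independently over $t$; $q_v:=\sum_{t}q_{tv}$. When a vertex of type $v$ arrives it may probe edges $(u,v)$ to unmatched offline vertices one at a time; an existing edge is matched irrevocably for reward $w_{uv}$ and probing of this arrival stops (probe-commit); a failed probe counts against the patience, and probing of this arrival stops when the patience is exhausted; all probing of an arrival happens before the next arrival. A policy $\pi$ is an ordered sequence of distinct offline vertices; following $\pi$ for a type-$v$ arrival means probing them in order until success, exhaustion of $\pi$, or exhaustion of patience. $\mathcal P$ is the set of all policies, and $p_{uv}(\pi)$ is the probability that a type-$v$ arrival following $\pi$ is matched to $u$ when all vertices of $\pi$ are unmatched. Policy LP: maximize $\sum_{v}\sum_{\pi\in\mathcal P}x_v(\pi)\sum_u p_{uv}(\pi)w_{uv}$ subject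 to $\sum_v\sum_\pi x_v(\pi)p_{uv}(\pi)\le1$ for all $u\in U$, $\sum_\pi x_v(\pi)=q_v$ for all $v\in V$, $x_v(\pi)\ge0$; its optimal value is $\mathsf{OPT}_{\mathsf{LPP}}$, which upper-bounds the expected matched weight of an offline algorithm knowing the realized types of all arrivals in advance (competitive ratios here are measured against $\mathsf{OPT}_{\mathsf{LPP}}$). Let $w^*_u=\sum_v w_{uv}\sum_\pi p_{uv}(\pi)x^*_v(\pi)$. Skip-Algorithm: at each time $t$, when a vertex of type $v$ arrives, sample a policy $\pi=(\pi_1,\dots,\pi_\ell)$ with probability $x^*_v(\pi)/q_v$; for $i=1,\dots,\ell$: if $w_{\pi_i v}<w^*_{\pi_i}/2$, skip $\pi_i$ (no probe, no patience used); else if $\pi_i$ is unmatched, probe $(\pi_i,v)$ and match on success; else perform a simulated probe: flip an independent coin with success probability $p_{\pi_i v}$, and on success stop processing this arrival without matching. Simulated probes are treated like real ones for continuation: a simulated failure counts as a failed attempt against the patience (for random patience, exhaustion after it is sampled by the algorithm from the conditional patience distribution). *)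

(* Defs.v *)
(* MathComp / MathComp-Analysis. *)
From mathcomp Require Import all_boot all_order all_algebra.
From mathcomp Require Import all_classical all_reals all_analysis.

Set Implicit Arguments.
Unset Strict Implicit.
Unset Printing Implicit Defensive.

Import Order.TTheory GRing.Theory Num.Theory.
Local Open Scope ring_scope.

(* Randomized programs with finite random draws; [mu] is the probability mass
   function of the draw. *)
Inductive prog (R : realType) (A : Type) : Type :=
| Ret of A
| Draw (D : finType) (mu : D -> R) (k : D -> prog R A).
Arguments Ret {R A} a.
Arguments Draw {R A} D mu k.

Fixpoint bind (R : realType) (A B : Type) (m : prog R A) (f : A -> prog R B)
    : prog R B :=
  match m with
  | Ret a => f a
  | Draw D mu k => Draw D mu (fun i => bind (k i) f)
  end.

Definition coin (R : realType) (c : R) : prog R bool :=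
  Draw bool (fun b => if b then c else 1 - c) Ret.

Fixpoint expect (R : realType) (A : Type) (m : prog R A) (f : A -> R) : R :=
  match m with
  | Ret a => f a
  | Draw D mu k => \sum_(i : D) mu i * expect (k i) f
  end.

Definition prob (R : realType) (A : Type) (m : prog R A) (E : pred A) : R :=
  expect m (fun a => (E a)%:R).

(* [patience v] is the law of the patience of a type-v arrival; a
   deterministic patience is a Dirac mass. *)
Record instance (R : realType) (U V : finType) (T : nat) := Instance {
  weight : U -> V -> R;
  edge_prob : U -> V -> R;
  patience : V -> probability nat R;
  arrival : 'I_T -> V -> R;
  weight_ge0 : forall u v, 0 <= weight u v;
  edge_prob_ge0 : forall u v, 0 <= edge_prob u v;
  edge_prob_le1 : forall u v, edge_prob u v <= 1;
  patience_gt0 : forall v, patience v [set 0%N]%classic = 0%E;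
  arrival_ge0 : forall t v, 0 <= arrival t v;
  arrival_sum1 : forall t, \sum_v arrival t v = 1
}.

(* Duplicate-free sequences over U; their length is automatically at most
   #|U|, so the bound only serves to make the type finite. *)
Definition policy (U : finType) := {s : #|U|.-bseq U | uniq s}.

Section Policies.
Context (R : realType) (U V : finType) (T : nat) (G : instance R U V T).
Implicit Types (u : U) (v : V) (s : seq U) (x : V -> policy U -> R).

Definition expected_arrivals v : R := \sum_(t < T) arrival G t v.

(* P(L = k | L >= k) for the patience L of type v: the probability that the
   k-th failed attempt exhausts the patience, given that the previous k - 1
   failed attempts did not.  Since the patience is observed only upon
   exhaustion, drawing L beforehand or exhausting the arrival with these
   conditional probabilities gives the same process. *)
Definition exhaust_prob v (k : nat) : R :=
  fine (patience G v [set k]%classic)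
  / fine (patience G v [set l | (k <= l)%N]%classic).

(* The offline vertex, if any, matched to a type-v arrival that follows the
   sequence s of unmatched vertices, its first probe being attempt number k. *)
Fixpoint follow v (k : nat) s : prog R (option U) :=
  if s is u :: s' then
    bind (coin (edge_prob G u v)) (fun success =>
      if success then Ret (Some u)
      else bind (coin (exhaust_prob v k)) (fun exhausted =>
        if exhausted then Ret None else follow v k.+1 s'))
  else Ret None.

Definition match_prob u v (pi : policy U) : R :=
  prob (follow v 1 (val pi)) (pred1 (Some u)).

Definition lpp_feasible x : Prop :=
  [/\ forall u, \sum_v \sum_(pi : policy U) x v pi * match_prob u v pi <= 1,
      forall v, \sum_(pi : policy U) x v pi = expected_arrivals v
    & forall v pi, 0 <= x v pi].

Definition lpp_value x : R :=
  \sum_v \sum_(pi : policy U) x v pi * \sum_u match_prob u v pi * weight G u v.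

(* The feasible set is nonempty (the empty policy is allowed) and compact. *)
Definition opt_lpp : R :=
  sup [set lpp_value x | x in [set x | lpp_feasible x]]%classic.

Definition wstar x u : R :=
  \sum_v weight G u v * \sum_(pi : policy U) match_prob u v pi * x v pi.

(* Processing of a type-v arrival when M is the set of matched offline
   vertices.  The coin of bias [edge_prob G u v] is a real probe when u is
   unmatched and a simulated one otherwise; k counts the attempts of both
   kinds. *)
Fixpoint skip_arrival x v (M : {set U}) (k : nat) s : prog R (option U) :=
  if s is u :: s' then
    if weight G u v < wstar x u / 2 then skip_arrival x v M k s'
    else bind (coin (edge_prob G u v)) (fun success =>
      if success then Ret (if u \in M then None else Some u)
      else bind (coin (exhaust_prob v k)) (fun exhausted =>
        if exhausted then Ret None else skip_arrival x v M k.+1 s'))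
  else Ret None.

(* Treats the arrivals at the times in ts, starting with matched vertices M
   and collected weight W, and returns the total collected weight. *)
Fixpoint skip_run x (ts : seq 'I_T) (M : {set U}) (W : R) : prog R R :=
  if ts is t :: ts' then
    Draw V (arrival G t) (fun v =>
      Draw (policy U) (fun pi => x v pi / expected_arrivals v) (fun pi =>
        bind (skip_arrival x v M 1 (val pi)) (fun o =>
          if o is Some u then skip_run x ts' (u |: M)%SET (W + weight G u v)
          else skip_run x ts' M W)))
  else Ret W.

Definition skip_expected_weight x : R :=
  expect (skip_run x (enum 'I_T) (@finset.set0 U) 0) id.

End Policies.

(* Main.v *)
(* For a fixed offline vertex u, let theta be w*_u / 2.  While u is free, the
   chance that the arrival at time t is of type v and gets matched to u does not
   depend on the set of matched vertices, because simulated probes imitate real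
   ones.  Hence the expected reward splits as a sum over u of the value R_u of a
   single-item problem.  Writing each accepted weight as theta plus a surplus,
   and F for the probability that u stays free until the end,
     R_u >= theta * (1 - F) + F * (total expected surplus when u is free),
   and LP feasibility bounds the total surplus below by w*_u - theta = theta:
   skipping vertices only leaves more patience for those that are not skipped. *)
Require Import Defs.
From mathcomp Require Import all_boot all_order all_algebra.
From mathcomp Require Import all_classical all_reals all_analysis.
From mathcomp Require Import ring lra.

Set Implicit Arguments.
Unset Strict Implicit.
Unset Printing Implicit Defensive.

Import Order.TTheory GRing.Theory Num.Theory.
Local Open Scope ring_scope.

(** * Expectations of finite random programs *)

Section Expectation.
Context (R : realType).

(** [prog] accepts any function as a mass function. Only programs for a single arrival are shown to
    be proper: [skip_run] can fail to be, because of types that never arrive. *)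
Fixpoint proper (A : Type) (m : prog R A) : Prop :=
  match m with
  | Ret _ => True
  | Draw D mu k =>
      [/\ forall i, 0 <= mu i, \sum_i mu i = 1 & forall i, proper (k i)]
  end.

Lemma proper_bind (A B : Type) (m : prog R A) (f : A -> prog R B) :
  proper m -> (forall a, proper (f a)) -> proper (bind m f).
Proof.
move=> pm pf; elim: m pm => [a|D mu k IH] //= [mu0 mu1 pk].
by split=> // i; apply: IH.
Qed.

Lemma proper_coin (c : R) : 0 <= c <= 1 -> proper (coin c).
Proof.
move=> /andP[c0 c1]; split=> //; first by case=> //; rewrite subr_ge0.
by rewrite big_bool /= addrC subrK.
Qed.

Lemma expect_bind (A B : Type) (m : prog R A) (f : A -> prog R B) (h : B -> R) :
  expect (bind m f) h = expect m (fun a => expect (f a) h).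
Proof.
by elim: m => [a|D mu k IH] //=; apply: eq_bigr => i _; rewrite IH.
Qed.

Lemma eq_expect (A : Type) (m : prog R A) (f g : A -> R) :
  f =1 g -> expect m f = expect m g.
Proof.
move=> fg; elim: m => [a|D mu k IH] //=.
by apply: eq_bigr => i _; rewrite IH.
Qed.

Lemma expectD (A : Type) (m : prog R A) (f g : A -> R) :
  expect m (fun a => f a + g a) = expect m f + expect m g.
Proof.
elim: m => [a|D mu k IH] //=.
by rewrite -big_split; apply: eq_bigr => i _; rewrite IH mulrDr.
Qed.

Lemma expectZ (A : Type) (m : prog R A) (f : A -> R) (c : R) :
  expect m (fun a => f a * c) = expect m f * c.
Proof.
elim: m => [a|D mu k IH] //=.
by rewrite mulr_suml; apply: eq_bigr => i _; rewrite IH mulrA.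
Qed.

Lemma expect_cst (A : Type) (m : prog R A) (c : R) :
  proper m -> expect m (fun=> c) = c.
Proof.
elim: m => [a|D mu k IH] //= [_ mu1 pk].
transitivity (\sum_i mu i * c); first by apply: eq_bigr => i _; rewrite IH.
by rewrite -mulr_suml mu1 mul1r.
Qed.

Lemma expect_sum (A : Type) (I : finType) (m : prog R A) (f : I -> A -> R) :
  expect m (fun a => \sum_i f i a) = \sum_i expect m (f i).
Proof.
elim: m => [a|D mu k IH] //=.
rewrite exchange_big; apply: eq_bigr => i _.
by rewrite IH mulr_sumr.
Qed.

Lemma ler_expect (A : Type) (m : prog R A) (f g : A -> R) :
  proper m -> (forall a, f a <= g a) -> expect m f <= expect m g.
Proof.
move=> + fg; elim: m => [a|D mu k IH] //= [mu0 _ pk].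
by apply: ler_sum => i _; apply: ler_wpM2l => //; apply: IH.
Qed.

Lemma prob_ge0 (A : Type) (m : prog R A) (E : pred A) : proper m -> 0 <= prob m E.
Proof.
by move=> pm; rewrite -[leLHS](expect_cst 0 pm); apply: ler_expect.
Qed.

Lemma prob_le1 (A : Type) (m : prog R A) (E : pred A) : proper m -> prob m E <= 1.
Proof.
move=> pm; rewrite -[leRHS](expect_cst 1 pm); apply: ler_expect => // a.
by case: (E a).
Qed.

(** Splitting off [f None] leaves one increment per vertex, so the probability of ending unmatched
    never has to be computed. *)
Lemma expect_option (A : finType) (m : prog R (option A)) (f : option A -> R) :
  proper m ->
  expect m f =
  f None + \sum_a prob m (pred1 (Some a)) * (f (Some a) - f None).
Proof.
move=> pm.
rewrite -[X in X + _](expect_cst (f None) pm).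
under eq_bigr => a _ do rewrite /prob -expectZ.
rewrite -expect_sum -expectD; apply: eq_expect => -[b|] /=.
  rewrite (bigD1 b) //= eqxx mul1r big1 ?addr0 ?(addrC (f None)) ?subrK //.
  move=> a ab; case: eqP => [[ba]|_]; last by rewrite mul0r.
  by rewrite ba eqxx in ab.
by rewrite big1 ?addr0 // => a _; rewrite mul0r.
Qed.

End Expectation.

Section SkipAlgorithm.
Context (R : realType) (U V : finType) (T : nat) (G : instance R U V T).
Implicit Types (u : U) (v : V) (s : seq U) (M : {set U}).

(** * Outcome of a single arrival *)

Lemma exhaust_prob_itv v k : 0 <= exhaust_prob G v k <= 1.
Proof.
rewrite /exhaust_prob; set a := fine _; set b := fine _.
have a0 : 0 <= a by apply/fine_ge0/measure_ge0.
have b0 : 0 <= b by apply/fine_ge0/measure_ge0.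
have ab : a <= b.
  apply: fine_le; [exact: fin_num_measure|exact: fin_num_measure|].
  by apply: le_measure; rewrite ?inE // => l ->; rewrite /= leqnn.
rewrite divr_ge0 //=; have [b_gt0|] := ltP 0 b.
  by rewrite ler_pdivrMr // mul1r.
(* A null tail makes the quotient 0 by the convention for division. *)
by move=> b_le0; have -> : b = 0 by [lra|]; rewrite invr0 mulr0.
Qed.

Lemma edge_prob_itv u v : 0 <= edge_prob G u v <= 1.
Proof. by rewrite edge_prob_ge0 edge_prob_le1. Qed.

Lemma proper_follow v k s : proper (follow G v k s).
Proof.
elim: s k => [|a s IH] k //=.
apply: (proper_bind (proper_coin (edge_prob_itv a v))) => -[//|].
by apply: (proper_bind (proper_coin (exhaust_prob_itv v k))) => -[].
Qed.

Variable x : V -> policy U -> R.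

Lemma proper_skip_arrival v M k s : proper (skip_arrival G x v M k s).
Proof.
elim: s k => [|a s IH] k //=; case: ifP => // _.
apply: (proper_bind (proper_coin (edge_prob_itv a v))) => -[//|].
by apply: (proper_bind (proper_coin (exhaust_prob_itv v k))) => -[].
Qed.

Lemma prob_follow_cons u v k a s :
  prob (follow G v k (a :: s)) (pred1 (Some u)) =
  edge_prob G a v * (a == u)%:R +
  (1 - edge_prob G a v) * ((1 - exhaust_prob G v k) *
    prob (follow G v k.+1 s) (pred1 (Some u))).
Proof.
by rewrite /prob /= !big_bool /= !big_bool /= mulr0 add0r.
Qed.

Lemma prob_skip_cons u v M k a s :
  prob (skip_arrival G x v M k (a :: s)) (pred1 (Some u)) =
  if weight G a v < wstar G x a / 2 then
    prob (skip_arrival G x v M k s) (pred1 (Some u))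
  else edge_prob G a v * ((a \notin M) && (a == u))%:R +
    (1 - edge_prob G a v) * ((1 - exhaust_prob G v k) *
      prob (skip_arrival G x v M k.+1 s) (pred1 (Some u))).
Proof.
rewrite /prob /=; case: ifP => // _.
rewrite /= !big_bool /= !big_bool /= mulr0 add0r.
by case: (a \in M).
Qed.

Lemma prob_skip_matched u v M k s : u \in M ->
  prob (skip_arrival G x v M k s) (pred1 (Some u)) = 0.
Proof.
move=> uM; elim: s k => [|a s IH] k //; rewrite prob_skip_cons !IH.
case: ifP => // _; case: (a =P u) => [->|_]; first by rewrite uM /= !mulr0 addr0.
by rewrite andbF !mulr0 addr0.
Qed.

Definition skip_prob u v s : R :=
  prob (skip_arrival G x v (@finset.set0 U) 1 s) (pred1 (Some u)).

(** Membership of another vertex in [M] decides only what a successful attempt returns, never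
    whether the arrival goes on, so it cannot affect reaching [u]. *)
Lemma prob_skip_free u v M s : u \notin M ->
  prob (skip_arrival G x v M 1 s) (pred1 (Some u)) = skip_prob u v s.
Proof.
move=> uM; rewrite /skip_prob; elim: s 1%N => [|a s IH] k //.
rewrite !prob_skip_cons !IH finset.in_set0 /=.
by case: (a =P u) => [->|_]; rewrite ?uM ?andbF.
Qed.

Lemma skip_prob_skipped u v s :
  weight G u v < wstar G x u / 2 -> skip_prob u v s = 0.
Proof.
move=> uv; rewrite /skip_prob; elim: s 1%N => [|a s IH] k //.
rewrite prob_skip_cons !IH; case: ifP => // av.
case: (a =P u) => [au|_]; first by rewrite au uv in av.
by rewrite andbF !mulr0 addr0.
Qed.

(** * Patience saved by skipping *)

(** By telescoping this is P(L >= k) for the patience L of type [v]: the chance that k - 1 failed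
    attempts leave patience for another. *)
Definition survival v k : R := \prod_(1 <= i < k) (1 - exhaust_prob G v i).

Lemma survivalS v k : (0 < k)%N ->
  survival v k.+1 = survival v k * (1 - exhaust_prob G v k).
Proof. by move=> k0; rewrite /survival big_nat_recr. Qed.

Lemma survival_ge0 v k : 0 <= survival v k.
Proof.
apply: prodr_ge0 => i _.
by have /andP[_ e1] := exhaust_prob_itv v i; rewrite subr_ge0.
Qed.

Lemma survival_anti v j k : (0 < j)%N -> (j <= k)%N ->
  survival v k <= survival v j.
Proof.
move=> j0; elim: k => [|k IH]; first by rewrite leqn0 => /eqP ->.
rewrite leq_eqVlt => /predU1P[-> //|jk].
rewrite survivalS ?(leq_trans j0) //; apply: le_trans (IH jk).
have /andP[e0 _] := exhaust_prob_itv v k.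
by rewrite ler_piMr ?survival_ge0 // gerBl.
Qed.

(* The attempt counters j <= k differ by the number of vertices skipped. *)
Lemma follow_le_skip u v j k s : wstar G x u / 2 <= weight G u v ->
  (0 < j)%N -> (j <= k)%N ->
  survival v k * prob (follow G v k s) (pred1 (Some u)) <=
  survival v j *
    prob (skip_arrival G x v (@finset.set0 U) j s) (pred1 (Some u)).
Proof.
move=> uv; elim: s j k => [|a s IH] j k j0 jk.
  by rewrite /prob /= !mulr0.
have k0 := leq_trans j0 jk.
have /andP[p0 p1] := edge_prob_itv a v.
rewrite prob_follow_cons prob_skip_cons finset.in_set0 /=.
set p := edge_prob G a v in p0 p1 *.
have split_survival i z y : (0 < i)%N -> survival v i *
    (p * z + (1 - p) * ((1 - exhaust_prob G v i) * y)) =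
    p * (survival v i * z) + (1 - p) * (survival v i.+1 * y).
  by move=> i0; rewrite survivalS //; ring.
rewrite split_survival //; case: ifP => av.
  have -> : (a == u) = false.
    by apply/eqP => au; rewrite au ltNge uv in av.
  (* Only [follow] spends an attempt on [a], so [k] advances and [j] stays; the factor [1 - p] is
     bounded by 1. *)
  rewrite !mulr0 add0r; apply: le_trans (IH j k.+1 j0 (leqW jk)).
  rewrite ler_piMl ?gerBl // mulr_ge0 ?survival_ge0 //.
  exact/prob_ge0/proper_follow.
rewrite split_survival //; apply: lerD; apply: ler_wpM2l => //.
- by apply: ler_wpM2r => //; apply: survival_anti.
- by rewrite subr_ge0.
- exact: IH.
Qed.

Lemma match_prob_le_skip u v (pi : policy U) :
  wstar G x u / 2 <= weight G u v -> match_prob G u v pi <= skip_prob u v (val pi).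
Proof.
move=> uv.
have := follow_le_skip (val pi) uv (ltn0Sn 0) (leqnn 1).
by rewrite /survival big_geq // !mul1r.
Qed.

Lemma match_prob_ge0 u v pi : 0 <= match_prob G u v pi.
Proof. exact/prob_ge0/proper_follow. Qed.

Lemma skip_prob_ge0 u v s : 0 <= skip_prob u v s.
Proof. exact/prob_ge0/proper_skip_arrival. Qed.

Lemma skip_prob_le1 u v s : skip_prob u v s <= 1.
Proof. exact/prob_le1/proper_skip_arrival. Qed.

(** * Decomposition into single-vertex problems *)

(** Conditional on [u] being free, the probability that the arrival at time [t] has type [v] and is
    matched to [u]. *)
Definition hit u (t : 'I_T) v : R :=
  arrival G t v *
  \sum_(pi : policy U) x v pi / expected_arrivals G v * skip_prob u v (val pi).

Fixpoint vertex_reward u (ts : seq 'I_T) : R :=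
  if ts is t :: ts' then
    \sum_v hit u t v * weight G u v +
    (1 - \sum_v hit u t v) * vertex_reward u ts'
  else 0.

Hypothesis feas : lpp_feasible G x.

Lemma expected_arrivals_ge0 v : 0 <= expected_arrivals G v.
Proof. by apply: sumr_ge0 => t _; apply: arrival_ge0. Qed.

Lemma feasible_eq0 v pi : expected_arrivals G v = 0 -> x v pi = 0.
Proof.
case: feas => _ sum_x x0 qv; have := sum_x v; rewrite qv => /eqP.
by rewrite psumr_eq0 // => /allP/(_ pi); rewrite mem_index_enum => /(_ isT)/eqP.
Qed.

Lemma arrival_eq0 t v : expected_arrivals G v = 0 -> arrival G t v = 0.
Proof.
move=> /eqP; rewrite psumr_eq0 => [|i _]; last exact: arrival_ge0.
by move=> /allP/(_ t); rewrite mem_index_enum => /(_ isT)/eqP.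
Qed.

(* When type v never arrives, the sampling law is [0 / 0 = 0] and has mass 0. *)
Lemma sampling_mass t v :
  arrival G t v * \sum_pi x v pi / expected_arrivals G v = arrival G t v.
Proof.
case: feas => _ sum_x _; have [qv|qv] := eqVneq (expected_arrivals G v) 0.
  by rewrite arrival_eq0 // mul0r.
by rewrite -mulr_suml sum_x divff // mulr1.
Qed.

Lemma sampling_ge0 v pi : 0 <= x v pi / expected_arrivals G v.
Proof. by case: feas => _ _ x0; rewrite divr_ge0 ?expected_arrivals_ge0. Qed.

Lemma hit_ge0 u t v : 0 <= hit u t v.
Proof.
rewrite mulr_ge0 ?arrival_ge0 // sumr_ge0 // => pi _.
by rewrite mulr_ge0 ?sampling_ge0 ?skip_prob_ge0.
Qed.

Lemma sum_hit_le1 u t : \sum_v hit u t v <= 1.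
Proof.
rewrite -(arrival_sum1 G t); apply: ler_sum => v _.
rewrite -[leRHS]sampling_mass ler_wpM2l ?arrival_ge0 //.
by apply: ler_sum => pi _; rewrite ler_piMr ?sampling_ge0 ?skip_prob_le1.
Qed.

(** Matching [u] now earns its weight but forfeits its future value [vertex_reward u ts]; every
    other free vertex keeps its own future value. *)
Lemma expect_skip_run ts M W :
  expect (skip_run G x ts M W) id = W + \sum_(u | u \notin M) vertex_reward u ts.
Proof.
elim: ts M W => [|t ts IH] M W /=; first by rewrite big1 ?addr0.
set S := \sum_(u | u \notin M) vertex_reward u ts.
have arrivalE v (pi : policy U) :
    expect (bind (skip_arrival G x v M 1 (val pi)) (fun o =>
      if o is Some u then skip_run G x ts (u |: M)%SET (W + weight G u v)
      else skip_run G x ts M W)) id =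
    W + S + \sum_(u | u \notin M)
      skip_prob u v (val pi) * (weight G u v - vertex_reward u ts).
  rewrite expect_bind (expect_option _ (proper_skip_arrival _ _ _ _)) IH -/S.
  congr (_ + _); rewrite [RHS]big_mkcond; apply: eq_bigr => u _.
  case: ifP => [uM|/negbFE uM]; last by rewrite prob_skip_matched ?mul0r.
  rewrite prob_skip_free // IH; congr (_ * _).
  have -> : S = vertex_reward u ts +
      \sum_(a | a \notin (u |: M)%SET) vertex_reward a ts.
    rewrite /S (bigD1 u) //=; congr (_ + _); apply: eq_bigl => a.
    by rewrite finset.in_setU1 negb_or andbC.
  ring.
transitivity (\sum_v (arrival G t v * (W + S) + \sum_(u | u \notin M)
    hit u t v * (weight G u v - vertex_reward u ts))).
  apply: eq_bigr => v _.
  under eq_bigr => pi _ do rewrite arrivalE mulrDr.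
  rewrite big_split /= -mulr_suml mulrDr mulrA sampling_mass; congr (_ + _).
  under eq_bigr => pi _ do rewrite mulr_sumr.
  rewrite exchange_big mulr_sumr; apply: eq_bigr => u _.
  rewrite /hit -mulrA mulr_suml; congr (_ * _).
  by apply: eq_bigr => pi _; rewrite mulrA.
rewrite big_split /= -mulr_suml arrival_sum1 mul1r exchange_big -addrA.
congr (_ + _); rewrite -big_split; apply: eq_bigr => u _ /=.
under eq_bigr => v _ do rewrite mulrBr.
rewrite sumrB -mulr_suml; ring.
Qed.

(** * Lower bound for one offline vertex *)

Section Vertex.
Variable u : U.
Let theta : R := wstar G x u / 2.

(** A weight below [theta] makes the second factor negative, but then [u] is skipped and the first
    factor vanishes. *)
Lemma hit_surplus_ge0 t v : 0 <= hit u t v * (weight G u v - theta).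
Proof.
have [uv|uv] := leP theta (weight G u v).
  by rewrite mulr_ge0 ?hit_ge0 ?subr_ge0.
rewrite /hit big1 ?mulr0 ?mul0r // => pi _.
by rewrite skip_prob_skipped ?mulr0.
Qed.

(** In the induction the surplus [c] of the first arrival is collected in full, while the claim asks
    only for the fraction [(1 - A) * F] of it. The bounds on [F] belong to the claim because this
    comparison uses them. *)
Lemma vertex_reward_ge ts :
  let F := \prod_(t <- ts) (1 - \sum_v hit u t v) in
  theta * (1 - F) +
    F * \sum_(t <- ts) \sum_v hit u t v * (weight G u v - theta)
  <= vertex_reward u ts /\ 0 <= F <= 1.
Proof.
elim: ts => [|t ts [IH /andP[F0 F1]]] /=.
  by rewrite !big_nil subrr !mulr0 addr0 ler01 !lexx.
rewrite !big_cons.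
set F := \prod_(_ <- _) _ in IH F0 F1 *; set C := \sum_(_ <- _) _ in IH *.
set c := \sum_v hit u t v * (weight G u v - theta).
set A := \sum_v hit u t v.
have c0 : 0 <= c by apply: sumr_ge0 => v _; apply: hit_surplus_ge0.
have A0 : 0 <= A by apply: sumr_ge0 => v _; apply: hit_ge0.
have A1 : 0 <= 1 - A by rewrite subr_ge0 sum_hit_le1.
have -> : \sum_v hit u t v * weight G u v = A * theta + c.
  rewrite /c; under [X in _ = _ + X]eq_bigr => v _ do rewrite mulrBr.
  by rewrite sumrB -mulr_suml addrC subrK.
have F'0 : 0 <= (1 - A) * F by rewrite mulr_ge0.
have F'1 : (1 - A) * F <= 1 by rewrite mulr_ile1 // gerBl.
split; last by rewrite F'0.
have := ler_wpM2l A1 IH.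
have : (1 - A) * F * c <= c by rewrite ler_piMl.
lra.
Qed.

Lemma wstar_ge0 : 0 <= wstar G x u.
Proof.
case: feas => _ _ x0; apply: sumr_ge0 => v _; rewrite mulr_ge0 ?weight_ge0 //.
by apply: sumr_ge0 => pi _; rewrite mulr_ge0 ?match_prob_ge0.
Qed.

(** Replacing the hits by the LP match probabilities lowers the sum, type by type. The LP sum is
    [wstar G x u] minus [theta] times the LP load of [u], which is at most 1. *)
Lemma total_surplus_ge :
  theta <= \sum_(t <- enum 'I_T) \sum_v hit u t v * (weight G u v - theta).
Proof.
case: (feas) => match_le1 _ x0; rewrite big_enum exchange_big /=.
apply: (@le_trans _ _ (\sum_v (\sum_pi x v pi * match_prob G u v pi) *
    (weight G u v - theta))).
  under eq_bigr => v _ do rewrite mulrBr.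
  rewrite sumrB -mulr_suml.
  have -> : \sum_v (\sum_pi x v pi * match_prob G u v pi) * weight G u v
      = wstar G x u.
    apply: eq_bigr => v _; rewrite mulrC; congr (_ * _).
    by apply: eq_bigr => pi _; rewrite mulrC.
  have : (\sum_v \sum_pi x v pi * match_prob G u v pi) * theta <= theta.
    by rewrite ler_piMl ?match_le1 // divr_ge0 ?wstar_ge0.
  rewrite /theta; lra.
apply: ler_sum => v _; rewrite -mulr_suml.
have -> : \sum_t hit u t v = \sum_pi x v pi * skip_prob u v (val pi).
  rewrite /hit -mulr_suml -/(expected_arrivals G v) mulr_sumr.
  apply: eq_bigr => pi _.
  (* For a type that never arrives both sides are 0, as feasibility forces [x v pi = 0]; otherwise
     the total arrival probability cancels the divisor. *)
  have [qv|qv] := eqVneq (expected_arrivals G v) 0.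
    by rewrite qv feasible_eq0 // !mul0r.
  by rewrite mulrA; congr (_ * _); rewrite mulrC divfK.
have [uv|uv] := leP theta (weight G u v).
  rewrite ler_wpM2r ?subr_ge0 //; apply: ler_sum => pi _.
  by rewrite ler_wpM2l // match_prob_le_skip.
(* Below the threshold the algorithm never matches [u], whereas the LP term is nonpositive. *)
rewrite [X in _ <= X * _]big1 => [|pi _]; last by rewrite skip_prob_skipped ?mulr0.
rewrite mul0r mulr_ge0_le0 ?subr_le0 ?(ltW uv) // sumr_ge0 // => pi _.
by rewrite mulr_ge0 ?match_prob_ge0.
Qed.

(** Once the total surplus is at least [theta], the two terms of the bound combine to [theta] for
    every value of [F]. *)
Lemma vertex_reward_enum_ge : theta <= vertex_reward u (enum 'I_T).
Proof.
have [/= + /andP[F0 _]] := vertex_reward_ge (enum 'I_T).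
have := ler_wpM2l F0 total_surplus_ge; lra.
Qed.

End Vertex.

(** * Summation over the offline vertices *)

Lemma lpp_value_wstar : lpp_value G x = \sum_u wstar G x u.
Proof.
rewrite /wstar exchange_big; apply: eq_bigr => v _ /=.
under eq_bigr => pi _ do rewrite mulr_sumr.
rewrite exchange_big; apply: eq_bigr => u _ /=.
by rewrite mulr_sumr; apply: eq_bigr => pi _; ring.
Qed.

Lemma skip_expected_weight_ge : lpp_value G x / 2 <= skip_expected_weight G x.
Proof.
rewrite /skip_expected_weight expect_skip_run add0r lpp_value_wstar mulr_suml.
rewrite [leRHS](eq_bigl predT) => [|u]; last by rewrite finset.in_set0.
by apply: ler_sum => u _; apply: vertex_reward_enum_ge.
Qed.

End SkipAlgorithm.

Theorem theorem4 (R : realType) (U V : finType) (T : nat)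
    (G : instance R U V T) (kappa : R) (x : V -> policy U -> R) :
  0 < kappa -> kappa <= 1 ->
  lpp_feasible G x ->
  kappa * opt_lpp G <= lpp_value G x ->
  kappa / 2 * opt_lpp G <= skip_expected_weight G x.
Proof.
move=> _ _ feas x_val; apply: le_trans (skip_expected_weight_ge feas).
by rewrite mulrAC ler_pM2r // invr_gt0.
Qed.
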